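(* Let $n\ge 2$, let $\boldsymbol{X}$ be a nonnegative $n$-dimensional random vector with mean vector $\boldsymbol{\mu}=(\mu_1,\ldots,\mu_n)^\top$ and positive definite covariance matrix $\boldsymbol{\Sigma}$, and let $G=(V,E)$ be a connected simple undirected graph with $V=\{1,\ldots,n\}$, vertex degrees $d_1,\ldots,d_n$, and graph Laplacian $\boldsymbol{L}$. Let $\boldsymbol{M}=\operatorname{diag}(\mu_1,\ldots,\mu_n)$ and $$ \hat{\boldsymbol{A}}=\boldsymbol{I}-\hat{c}\,\boldsymbol{L}\boldsymbol{M}^{-1},\qquad \hat{c}=\frac{\operatorname{tr}\left(\boldsymbol{\Sigma}\boldsymbol{L}\boldsymbol{M}^{-1}\right)}{\operatorname{tr}\left(\boldsymbol{L}\boldsymbol{M}^{-1}\boldsymbol{\Sigma}\boldsymbol{M}^{-1}\boldsymbol{L}\right)}. $$ Then $\hat{\boldsymbol{A}}$ has all nonnegative entries if and only if $$ 1\ge\hat{c}\,\frac{d_i}{\mu_i}\ge 0 $$ for all $1\le i\le n$.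
   Context: $\boldsymbol{I}$ is the $n\times n$ identity matrix. $\boldsymbol{\mu}=\mathbb{E}[\boldsymbol{X}]$ and $\boldsymbol{\Sigma}=\mathbb{E}[(\boldsymbol{X}-\boldsymbol{\mu})(\boldsymbol{X}-\boldsymbol{\mu})^\top]$. Since $\boldsymbol{X}$ is entrywise nonnegative and $\boldsymbol{\Sigma}$ is positive definite, all $\mu_i>0$. $E$ is a set of unordered pairs of distinct vertices. The graph Laplacian is $\boldsymbol{L}=\boldsymbol{D}-\boldsymbol{W}$, where $\boldsymbol{W}$ is the adjacency matrix ($w_{ij}=1$ if $\{i,j\}\in E$ and $0$ otherwise) and $\boldsymbol{D}=\operatorname{diag}(d_1,\ldots,d_n)$ with $d_i$ the degree of vertex $i$. The denominator defining $\hat{c}$ is strictly positive in this setting. *)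

(* Defs.v *)
From HB Require Import structures.
From mathcomp Require Import all_boot all_order all_fingroup all_algebra.
From mathcomp Require Import all_classical all_reals all_analysis.

Set Implicit Arguments.
Unset Strict Implicit.
Unset Printing Implicit Defensive.

Import Order.TTheory GRing.Theory Num.Theory.

Local Open Scope ring_scope.

(* `fine` maps infinite expectations to 0, so these two definitions are
   meaningful for components in `Lfun P 2%:E`, where all moments involved are
   finite. *)
Definition mean_vec (d : measure_display) (T : measurableType d)
    (R : realType) (P : probability T R) (n : nat)
    (X : 'I_n -> {RV P >-> R}) : 'cV[R]_n :=
  \col_i fine 'E_P[X i].

Definition cov_mx (d : measure_display) (T : measurableType d)
    (R : realType) (P : probability T R) (n : nat)
    (X : 'I_n -> {RV P >-> R}) : 'M[R]_n :=
  \matrix_(i, j) fine (covariance P (X i) (X j)).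

Definition posdef_mx (R : realType) (n : nat) (S : 'M[R]_n) : Prop :=
  S^T = S /\ forall v : 'cV[R]_n, v != 0 -> 0 < (v^T *m S *m v) 0 0.

Definition nonneg_mx (R : realType) (m n : nat) (A : 'M[R]_(m, n)) : Prop :=
  forall i j, 0 <= A i j.

(* A simple graph on 'I_n is given by its edge set E, a set of unordered pairs
   of distinct vertices. *)
Definition is_edge_set (n : nat) (E : {set {set 'I_n}}) : Prop :=
  forall e, e \in E -> #|e| = 2%N.

(* For i = j the set [set i; j] is a singleton, so an edge set has no loops. *)
Definition adj (n : nat) (E : {set {set 'I_n}}) : rel 'I_n :=
  fun i j => [set i; j]%SET \in E.

Definition connected_graph (n : nat) (E : {set {set 'I_n}}) : Prop :=
  forall i j : 'I_n, connect (adj E) i j.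

Definition degree (n : nat) (E : {set {set 'I_n}}) (i : 'I_n) : nat :=
  #|[set j | adj E i j]%SET|.

Definition adj_mx (R : realType) (n : nat) (E : {set {set 'I_n}}) : 'M[R]_n :=
  \matrix_(i, j) (adj E i j)%:R.

Definition degree_mx (R : realType) (n : nat) (E : {set {set 'I_n}}) :
    'M[R]_n :=
  diag_mx (\row_i (degree E i)%:R).

Definition laplacian (R : realType) (n : nat) (E : {set {set 'I_n}}) :
    'M[R]_n :=
  degree_mx R E - adj_mx R E.

Definition chat (R : realType) (n : nat) (Sigma L M : 'M[R]_n) : R :=
  \tr (Sigma *m L *m invmx M) /
  \tr (L *m invmx M *m Sigma *m invmx M *m L).

Definition Ahat (R : realType) (n : nat) (Sigma L M : 'M[R]_n) : 'M[R]_n :=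
  1%:M - chat Sigma L M *: (L *m invmx M).

(* Main.v *)
Require Import Defs.
From HB Require Import structures.
From mathcomp Require Import all_boot all_order all_fingroup all_algebra.
From mathcomp Require Import all_classical all_reals all_analysis.
From mathcomp Require Import measurable_realfun.

(** The off-diagonal entries of [L M^-1] are [- w_ij / mu_j] and its diagonal
    entries are [d_i / mu_i], so the entries of [I - c L M^-1] are
    [1 - c d_i / mu_i] on the diagonal and [c w_ij / mu_j] off it.  The diagonal
    accounts for the upper bound in the equivalence.  For the lower bound, the
    off-diagonal entries of column [j] depend on [j] alone, apart from the factor
    [w_ij] in {0, 1}; as the graph is connected with at least two vertices, [w_ij]
    is 1 for some [i], so column [j] is nonnegative off the diagonal exactly when
    [0 <= c / mu_j], that is, when [0 <= c d_j / mu_j] since [d_j > 0]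
    ([degree_gt0]).

    This argument, [nonneg_perturbed_laplacian], rests on [M] being invertible,
    that is, on [mu] having nonzero entries ([mean_vec_neq0]).  The hypotheses
    on the random vector provide this: a nonnegative random variable
    of mean zero vanishes almost surely and has variance zero
    ([variance0_of_mean0]), whereas the diagonal entries of a positive definite
    matrix are positive. *)

Import Order.TTheory GRing.Theory Num.Theory.

Local Open Scope ring_scope.

(** Nonnegativity turns the mean into the L1 norm of [X], which vanishes only
    if [X] does almost everywhere. *)
Lemma variance0_of_mean0 (d : measure_display) (T : measurableType d)
    (R : realType) (P : probability T R) (X : {RV P >-> R}) :
  {ae P, forall w, 0 <= X w} -> (X : T -> R) \in Lfun P 2%:E ->
  ('E_P[X] = 0 -> covariance P X X = 0)%E.
Proof.
move=> X_ge0 X_L2 EX0.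
have X_L1 : (X : T -> R) \in Lfun P 1.
  by apply: Lfun_subset12 X_L2; exact: fin_num_measure.
have mX : measurable_fun setT (EFin \o X : T -> \bar R).
  by apply/measurable_EFinP; exact: measurable_funPT.
have X_eq0 : ae_eq P setT (EFin \o X : T -> \bar R) (cst 0%E).
  apply/(ae_eq_integral_abs _ measurableT mX).
  rewrite -EX0 unlock; apply: ae_eq_integral => //.
    exact: measurableT_comp.
  by apply: filterS X_ge0 => w Xw_ge0 _ /=; rewrite ger0_norm.
rewrite covarianceE ?Lfun2_mul_Lfun1 // EX0 mule0 sube0 unlock.
rewrite -[RHS](integral0 P setT); apply: ae_eq_integral => //.
  apply/measurable_EFinP; apply: measurable_funM; exact: measurable_funPT.
by apply: filterS X_eq0 => w /(_ I) /= [Xw0]; rewrite !fctE Xw0 mul0r.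
Qed.

Lemma posdef_mx_diag_gt0 (R : realType) (n : nat) (S : 'M[R]_n) (i : 'I_n) :
  posdef_mx S -> 0 < S i i.
Proof.
move=> [_ /(_ (delta_mx i 0))]; rewrite trmx_delta -rowE -colE !mxE; apply.
apply/eqP => /matrixP /(_ i 0) /eqP.
by rewrite !mxE !eqxx oner_eq0.
Qed.

Lemma mean_vec_neq0 (d : measure_display) (T : measurableType d)
    (R : realType) (P : probability T R) (n : nat) (X : 'I_n -> {RV P >-> R}) :
  (forall i, {ae P, forall w, 0 <= X i w}) ->
  (forall i, (X i : T -> R) \in Lfun P 2%:E) ->
  posdef_mx (cov_mx X) -> forall i, mean_vec X i 0 != 0.
Proof.
move=> X_ge0 X_L2 Sigma_posdef i; rewrite mxE; apply/eqP => fine_EX0.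
have := posdef_mx_diag_gt0 _ _ _ i Sigma_posdef; rewrite mxE.
rewrite variance0_of_mean0 ?ltxx //.
rewrite -[LHS]fineK ?fine_EX0 //; apply: expectation_fin_num.
by apply: Lfun_subset12 (X_L2 i); exact: fin_num_measure.
Qed.

Lemma adj_irrefl (n : nat) (E : {set {set 'I_n}}) (i : 'I_n) :
  is_edge_set E -> adj E i i = false.
Proof. by move=> Eedges; apply/negP => /Eedges; rewrite finset.setUid cards1. Qed.

Lemma adj_sym (n : nat) (E : {set {set 'I_n}}) (i j : 'I_n) :
  adj E i j = adj E j i.
Proof. by rewrite /adj finset.setUC. Qed.

(** The first edge of a path from [i] to another vertex leads to a neighbour. *)
Lemma exists_neighbour (n : nat) (E : {set {set 'I_n}}) (i : 'I_n) :
  (2 <= n)%N -> connected_graph E -> exists j, adj E i j.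
Proof.
move=> n_ge2 Econn.
have [j j_neq_i] : exists j : 'I_n, j != i.
  have : (0 < #|[set~ i]%SET|)%N by rewrite cardsC1 card_ord -ltnS prednK // ltnW.
  by case/card_gt0P => j; rewrite !inE; exists j.
have /connectP[[|k p] /=] := Econn i j; first by move=> _ /eqP; rewrite (negbTE j_neq_i).
by case/andP; exists k.
Qed.

Lemma degree_gt0 (n : nat) (E : {set {set 'I_n}}) (i : 'I_n) :
  (2 <= n)%N -> connected_graph E -> (0 < degree E i)%N.
Proof.
move=> n_ge2 Econn; have [j adj_ij] := exists_neighbour _ E i n_ge2 Econn.
by apply/card_gt0P; exists j; rewrite inE.
Qed.

Lemma invmx_diag (F : fieldType) (n : nat) (v : 'rV[F]_n) :
  (forall i, v 0 i != 0) -> invmx (diag_mx v) = diag_mx (\row_i (v 0 i)^-1).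
Proof.
move=> v_neq0; have : diag_mx v *m diag_mx (\row_i (v 0 i)^-1) = 1%:M.
  rewrite mulmx_diag -diag_const_mx; congr diag_mx.
  by apply/rowP => i; rewrite !mxE mulfV.
move=> vV1; have [v_unit _] := mulmx1_unit vV1.
by apply: (can_inj (mulKmx v_unit)); rewrite vV1 mulmxV.
Qed.

Lemma perturbed_laplacianE (R : realType) (n : nat) (E : {set {set 'I_n}})
    (c : R) (v : 'rV[R]_n) (i j : 'I_n) :
  is_edge_set E -> (forall k, v 0 k != 0) ->
  (1%:M - c *: (laplacian R E *m invmx (diag_mx v))) i j =
  if i == j then 1 - c * ((degree E i)%:R / v 0 i)
  else c * ((adj E i j)%:R / v 0 j).
Proof.
move=> Eedges v_neq0; rewrite invmx_diag // mul_mx_diag !mxE.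
case: eqVneq => [<-|_]; first by rewrite adj_irrefl // subr0.
by rewrite /= sub0r add0r mulNr mulrN opprK.
Qed.

(** An off-diagonal entry of column [j] is [0] or [c / v_j], and [c / v_j] has
    the sign of [c d_j / v_j] because [d_j > 0]; the value [c / v_j] does occur
    in the column because [j] has a neighbour. *)
Lemma nonneg_perturbed_laplacian (R : realType) (n : nat)
    (E : {set {set 'I_n}}) (c : R) (v : 'rV[R]_n) :
  (2 <= n)%N -> is_edge_set E -> connected_graph E ->
  (forall k, v 0 k != 0) ->
  nonneg_mx (1%:M - c *: (laplacian R E *m invmx (diag_mx v))) <->
  forall i, c * ((degree E i)%:R / v 0 i) <= 1 /\
            0 <= c * ((degree E i)%:R / v 0 i).
Proof.
move=> n_ge2 Eedges Econn v_neq0; split=> [A_ge0 j | bnd i j].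
- split.
    have := A_ge0 j j.
    by rewrite perturbed_laplacianE // eqxx subr_ge0.
  have [i adj_ji] := exists_neighbour _ E j n_ge2 Econn.
  have i_neq_j : i != j.
    by apply/eqP => eq_ij; move: adj_ji; rewrite eq_ij adj_irrefl.
  have := A_ge0 i j.
  rewrite perturbed_laplacianE // (negbTE i_neq_j) adj_sym adj_ji mul1r.
  by move=> c_div_ge0; rewrite mulrCA mulr_ge0.
- rewrite perturbed_laplacianE //; case: eqP => _.
    by rewrite subr_ge0; case: (bnd i).
  have [_] := bnd j; rewrite mulrCA pmulr_rge0 ?ltr0n ?degree_gt0 // => c_div_ge0.
  by rewrite mulrCA mulr_ge0.
Qed.

Theorem lemma2p2 (d : measure_display) (T : measurableType d) (R : realType)
    (P : probability T R) (n : nat) (hn : (2 <= n)%N)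
    (X : 'I_n -> {RV P >-> R})
    (X_ge0 : forall i, {ae P, forall w, 0 <= X i w})
    (X_L2 : forall i, (X i : T -> R) \in Lfun P 2%:E)
    (Sigma_posdef : posdef_mx (cov_mx X))
    (E : {set {set 'I_n}}) (E_edges : is_edge_set E)
    (E_conn : connected_graph E) :
  let mu := mean_vec X in
  let Sigma := cov_mx X in
  let L := laplacian R E in
  let M := diag_mx mu^T in
  nonneg_mx (Ahat Sigma L M) <->
  (forall i : 'I_n,
     1 >= chat Sigma L M * ((degree E i)%:R / mu i 0) /\
     chat Sigma L M * ((degree E i)%:R / mu i 0) >= 0).
Proof.
move=> mu Sigma L M.
have mu_neq0 i : mu^T 0 i != 0 by rewrite mxE; exact: mean_vec_neq0.
split=> [A_ge0 i | bnd].
  have := nonneg_perturbed_laplacian R n E (chat Sigma L M) mu^T hn E_edges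
    E_conn mu_neq0.
  by case=> /(_ A_ge0 i) + _; rewrite mxE.
apply/(nonneg_perturbed_laplacian R n E _ mu^T hn E_edges E_conn mu_neq0) => i.
by rewrite [mu^T 0 i]mxE; exact: bnd.
Qed.
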